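(* Let $n\in\mathbb{N}\setminus\{0\}$ and, for each $i\in\{1,\dots,n\}$, let $(X_i,d_i,W_i,\pi_i)$ be a smooth hyperbolic space. Put $X:=\prod_{i=1}^n X_i$ and, for $x=(x_1,\dots,x_n)$, $y=(y_1,\dots,y_n)$, $u=(u_1,\dots,u_n)$, $v=(v_1,\dots,v_n)\in X$ and $\lambda\in[0,1]$, define $d(x,y):=\left(\sum_{i=1}^n d_i^2(x_i,y_i)\right)^{1/2}$, $W(x,y,\lambda):=(W_1(x_1,y_1,\lambda),\dots,W_n(x_n,y_n,\lambda))$ and $\pi(\overrightarrow{xy},\overrightarrow{uv}):=\sum_{i=1}^n\pi_i(\overrightarrow{x_iy_i},\overrightarrow{u_iv_i})$. Then $(X,d,W,\pi)$ is a smooth hyperbolic space.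
   Context: A $W$-hyperbolic space is a triple $(X,d,W)$ where $(X,d)$ is a metric space and $W:X^2\times[0,1]\to X$ is such that, for all $x,y,z,w\in X$ and $\lambda,\mu\in[0,1]$: (W1) $d(z,W(x,y,\lambda))\le(1-\lambda)d(z,x)+\lambda d(z,y)$; (W2) $d(W(x,y,\lambda),W(x,y,\mu))=|\lambda-\mu|d(x,y)$; (W3) $W(x,y,\lambda)=W(y,x,1-\lambda)$; (W4) $d(W(x,z,\lambda),W(y,w,\lambda))\le(1-\lambda)d(x,y)+\lambda d(z,w)$. An ordered pair $(a,b)\in X^2$ is denoted by $\overrightarrow{ab}$, and $d^2(x,y)$ means $(d(x,y))^2$. A smooth hyperbolic space is a quadruple $(X,d,W,\pi)$ where $(X,d,W)$ is a $W$-hyperbolic space and $\pi:X^2\times X^2\to\mathbb{R}$ is such that, for any $x,y,z,u,v\in X$ and $\lambda\in[0,1]$: (P1) $\pi(\overrightarrow{xy},\overrightarrow{xy})=d^2(x,y)$; (P2) $\pi(\overrightarrow{xy},\overrightarrow{uv})=-\pi(\overrightarrow{yx},\overrightarrow{uv})=-\pi(\overrightarrow{xy},\overrightarrow{vu})$; (P3) $\pi(\overrightarrow{xy},\overrightarrow{uv})+\pi(\overrightarrow{yz},\overrightarrow{uv})=\pi(\overrightarrow{xz},\overrightarrow{uv})$; (P4) $\pi(\overrightarrow{xy},\overrightarrow{uv})\le d(x,y)d(u,v)$; (P5) $d^2(W(x,y,\lambda),z)\le(1-\lambda)^2d^2(x,z)+2\lambda\,\pi(\overrightarrow{yz},\overrightarrow{W(x,y,\lambda)z})$.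 *)

(* Defs.v *)
From mathcomp Require Import all_boot all_order all_algebra.
From mathcomp Require Import reals interval_inference.

Set Implicit Arguments.
Unset Strict Implicit.
Unset Printing Implicit Defensive.

Import Order.TTheory GRing.Theory Num.Theory.

Local Open Scope ring_scope.

(* The library's metricType attaches a fixed distance to its carrier.  Here the
   distance on the product is part of what is asserted, so being a metric is a
   predicate on an arbitrary function. *)
Record metric_space (R : realType) (X : Type) (d : X -> X -> R) : Prop := {
  metric_ge0 : forall x y, 0 <= d x y;
  metric_eq0 : forall x y, d x y = 0 <-> x = y;
  metric_sym : forall x y, d x y = d y x;
  metric_triangle : forall x y z, d x z <= d x y + d y z
}.

(* [{i01 R}] is the type of the reals in the closed interval [0, 1]. *)
Record W_hyperbolic_space (R : realType) (X : Type) (d : X -> X -> R)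
    (W : X -> X -> {i01 R} -> X) : Prop := {
  W_hyperbolic_metric : metric_space d;
  W1 : forall (x y z : X) (l : {i01 R}),
    d z (W x y l) <= (1 - l%:num) * d z x + l%:num * d z y;
  W2 : forall (x y : X) (l m : {i01 R}),
    d (W x y l) (W x y m) = `|l%:num - m%:num| * d x y;
  W3 : forall (x y : X) (l : {i01 R}),
    W x y l = W y x (1 - l%:num)%:i01;
  W4 : forall (x y z w : X) (l : {i01 R}),
    d (W x z l) (W y w l) <= (1 - l%:num) * d x y + l%:num * d z w
}.

Record smooth_hyperbolic_space (R : realType) (X : Type) (d : X -> X -> R)
    (W : X -> X -> {i01 R} -> X) (pi : X * X -> X * X -> R) : Prop := {
  smooth_W_hyperbolic : W_hyperbolic_space d W;
  P1 : forall x y : X, pi (x, y) (x, y) = d x y ^+ 2;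
  P2 : forall x y u v : X,
    pi (x, y) (u, v) = - pi (y, x) (u, v) /\
    - pi (y, x) (u, v) = - pi (x, y) (v, u);
  P3 : forall x y z u v : X,
    pi (x, y) (u, v) + pi (y, z) (u, v) = pi (x, z) (u, v);
  P4 : forall x y u v : X, pi (x, y) (u, v) <= d x y * d u v;
  P5 : forall (x y z : X) (l : {i01 R}),
    d (W x y l) z ^+ 2 <=
      (1 - l%:num) ^+ 2 * d x z ^+ 2 + 2 * l%:num * pi (y, z) (W x y l, z)
}.

Section Product.
Context (R : realType) (n : nat) (X : 'I_n -> Type).

Definition prod_dist (d : forall i, X i -> X i -> R) (x y : forall i, X i) : R :=
  Num.sqrt (\sum_(i < n) d i (x i) (y i) ^+ 2).

Definition prod_W (W : forall i, X i -> X i -> {i01 R} -> X i)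
    (x y : forall i, X i) (l : {i01 R}) : forall i, X i :=
  fun i => W i (x i) (y i) l.

Definition prod_pi (pi : forall i, X i * X i -> X i * X i -> R)
    (p q : (forall i, X i) * (forall i, X i)) : R :=
  \sum_(i < n) pi i (p.1 i, p.2 i) (q.1 i, q.2 i).

End Product.

(* Main.v *)
Require Import Defs.
From mathcomp Require Import all_boot all_order all_algebra.
From mathcomp Require Import reals interval_inference.
From mathcomp Require Import boolp ring.

(** The product distance is the Euclidean norm of the vector of componentwise
    distances.  Each metric or convexity inequality for the product is the
    corresponding inequality between vectors of componentwise distances,
    followed by the fact that the Euclidean norm is monotone on nonnegative
    vectors ([ler_l2norm]), subadditive (Minkowski, [l2norm_triangle]) and
    absolutely homogeneous ([l2normZ]); homogeneity alone gives (W2).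
    Axiom (P4) is the sum of the componentwise bounds followed by the
    Cauchy-Schwarz inequality ([l2norm_cauchy_schwarz]).  The
    axioms (P1), (P2), (P3) and (P5) are linear in the squared distances and in
    the values of the form [pi], so they are obtained by summing over the
    components.  Equalities between points of the
    product are equalities of dependent functions, proved componentwise by
    function extensionality. *)

Set Implicit Arguments.
Unset Strict Implicit.
Unset Printing Implicit Defensive.

Local Open Scope ring_scope.

Import Order.TTheory GRing.Theory Num.Theory.

Section EuclideanNorm.
Context (R : rcfType) (n : nat).
Implicit Types f g : 'I_n -> R.

(** The Euclidean norm of a finite real vector, given as a function of its
    index. *)
Definition l2norm f : R := Num.sqrt (\sum_(i < n) f i ^+ 2).

Lemma sum_sqr_ge0 f : 0 <= \sum_(i < n) f i ^+ 2.
Proof. by apply: sumr_ge0 => i _; exact: sqr_ge0. Qed.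

Lemma l2norm_ge0 f : 0 <= l2norm f.
Proof. exact: sqrtr_ge0. Qed.

Lemma l2norm_sqr f : l2norm f ^+ 2 = \sum_(i < n) f i ^+ 2.
Proof. by rewrite sqr_sqrtr ?sum_sqr_ge0. Qed.

Lemma eq_l2norm f g : f =1 g -> l2norm f = l2norm g.
Proof. by move=> fg; congr Num.sqrt; apply: eq_bigr => i _; rewrite fg. Qed.

Lemma l2norm_eq0 f : l2norm f = 0 -> forall i, f i = 0.
Proof.
move=> f0 i; have S0 : \sum_(i < n) f i ^+ 2 = 0.
  by rewrite -l2norm_sqr f0 expr0n.
apply/eqP; rewrite -sqrf_eq0; apply/eqP.
by apply: (psumr_eq0P _ S0) => // j _; exact: sqr_ge0.
Qed.

Lemma ler_l2norm f g :
  (forall i, 0 <= f i) -> (forall i, f i <= g i) -> l2norm f <= l2norm g.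
Proof.
move=> f0 fg; apply: ler_wsqrtr; apply: ler_sum => i _.
by rewrite lerXn2r ?nnegrE // (le_trans (f0 i)).
Qed.

Lemma l2normZ (c : R) f : l2norm (fun i => c * f i) = `|c| * l2norm f.
Proof.
rewrite -sqrtr_sqr -sqrtrM ?sqr_ge0 // mulr_sumr.
by congr Num.sqrt; apply: eq_bigr => i _; rewrite exprMn.
Qed.

(** Cauchy-Schwarz, from Lagrange's identity: the difference of the squares of
    the two sides is half the sum of all [(f i * g j - f j * g i) ^+ 2]. *)
Lemma l2norm_cauchy_schwarz f g :
  \sum_(i < n) f i * g i <= l2norm f * l2norm g.
Proof.
apply: (le_trans (ler_norm _)).
rewrite -(@ler_pXn2r _ 2) ?nnegrE ?mulr_ge0 ?l2norm_ge0 //.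
rewrite real_normK ?num_real // exprMn !l2norm_sqr -(@ler_pM2r _ 2) //.
rewrite -subr_ge0.
set A := \sum_(i < n) f i ^+ 2; set B := \sum_(i < n) g i ^+ 2.
set C := \sum_(i < n) f i * g i.
have -> : A * B * 2 - C ^+ 2 * 2
        = \sum_(i < n) \sum_(j < n) (f i * g j - f j * g i) ^+ 2.
  have -> : A * B * 2 - C ^+ 2 * 2 = A * B + B * A - 2 * (C * C) by ring.
  rewrite /A /B /C !big_distrlr mulr_sumr -sumrN -!big_split /=.
  apply: eq_bigr => i _; rewrite mulr_sumr -sumrN -!big_split /=.
  by apply: eq_bigr => j _; ring.
by apply: sumr_ge0 => i _; exact: sum_sqr_ge0.
Qed.

(** Minkowski's inequality: expanding the square of the left side, the cross
    term is bounded by Cauchy-Schwarz. *)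
Lemma l2norm_triangle f g :
  l2norm (fun i => f i + g i) <= l2norm f + l2norm g.
Proof.
rewrite -(@ler_pXn2r _ 2) ?nnegrE ?addr_ge0 ?l2norm_ge0 //.
rewrite sqrrD !l2norm_sqr.
under eq_bigr do rewrite sqrrD.
rewrite !big_split /= lerD2r lerD2l mulr2n.
by apply: lerD; exact: l2norm_cauchy_schwarz.
Qed.

(** A vector of nonnegative numbers bounded by a combination, with nonnegative
    coefficients, of two vectors has norm at most the same combination of the
    norms. *)
Lemma l2norm_le_comb (a b : R) (h f g : 'I_n -> R) :
  0 <= a -> 0 <= b -> (forall i, 0 <= h i) ->
  (forall i, h i <= a * f i + b * g i) ->
  l2norm h <= a * l2norm f + b * l2norm g.
Proof.
move=> a0 b0 h0 hfg; apply: (le_trans (ler_l2norm h0 hfg)).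
apply: (le_trans (l2norm_triangle _ _)).
by rewrite !l2normZ !ger0_norm.
Qed.

End EuclideanNorm.

Section ProductSpace.
Context (R : realType) (n : nat) (X : 'I_n -> Type).
Context (d : forall i : 'I_n, X i -> X i -> R).

Lemma prod_distE (x y : forall i, X i) :
  prod_dist d x y = l2norm (fun i => d (x i) (y i)).
Proof. by []. Qed.

Lemma prod_metric_space :
  (forall i, metric_space (@d i)) -> metric_space (prod_dist d).
Proof.
move=> dm; split.
- by move=> x y; exact: l2norm_ge0.
- move=> x y; split=> [xy0|<-].
    apply: functional_extensionality_dep => i.
    by apply/(metric_eq0 (dm i)); exact: (l2norm_eq0 xy0).
  rewrite /prod_dist big1 ?sqrtr0 // => i _.
  by rewrite (metric_eq0 (dm i) _ _).2 // expr0n.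
- by move=> x y; apply: eq_l2norm => i; exact: metric_sym.
- move=> x y z; apply: (le_trans _ (l2norm_triangle _ _)).
  apply: ler_l2norm => i; first exact: (metric_ge0 (dm i)).
  exact: (metric_triangle (dm i)).
Qed.

Context (W : forall i : 'I_n, X i -> X i -> {i01 R} -> X i).

Lemma prod_W_hyperbolic_space :
  (forall i, W_hyperbolic_space (@d i) (@W i)) ->
  W_hyperbolic_space (prod_dist d) (prod_W W).
Proof.
move=> hW; have dm i := W_hyperbolic_metric (hW i).
have d0 i := metric_ge0 (dm i).
have l0 (l : {i01 R}) : 0 <= l%:num by [].
have l1 (l : {i01 R}) : 0 <= 1 - l%:num by rewrite subr_ge0.
split; first exact: prod_metric_space.
- move=> x y z l; apply: l2norm_le_comb => // i; exact: (W1 (hW i)).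
- move=> x y l m; rewrite !prod_distE -[X in X * _]normr_id -l2normZ.
  by apply: eq_l2norm => i; exact: (W2 (hW i)).
- move=> x y l; apply: functional_extensionality_dep => i.
  exact: (W3 (hW i)).
- move=> x y z w l; apply: l2norm_le_comb => // i; exact: (W4 (hW i)).
Qed.

End ProductSpace.

Theorem proposition3p6 (R : realType) (n : nat) (n_gt0 : (0 < n)%N)
    (X : 'I_n -> Type)
    (d : forall i : 'I_n, X i -> X i -> R)
    (W : forall i : 'I_n, X i -> X i -> {i01 R} -> X i)
    (pi : forall i : 'I_n, X i * X i -> X i * X i -> R)
    (smooth : forall i : 'I_n, smooth_hyperbolic_space (d i) (W i) (pi i)) :
  smooth_hyperbolic_space (prod_dist d) (prod_W W) (prod_pi pi).
Proof.
split.
- by apply: prod_W_hyperbolic_space => i; case: (smooth i).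
- move=> x y; rewrite prod_distE l2norm_sqr.
  by apply: eq_bigr => i _; exact: (P1 (smooth i)).
- move=> x y u v; rewrite -!sumrN.
  by split; apply: eq_bigr => i _; case: (P2 (smooth i) (x i) (y i) (u i) (v i)).
- move=> x y z u v; rewrite -big_split.
  by apply: eq_bigr => i _; exact: (P3 (smooth i)).
- move=> x y u v; apply: (le_trans _ (l2norm_cauchy_schwarz _ _)).
  by apply: ler_sum => i _; exact: (P4 (smooth i)).
- move=> x y z l; rewrite !prod_distE !l2norm_sqr !mulr_sumr -big_split.
  by apply: ler_sum => i _; exact: (P5 (smooth i)).
Qed.
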